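(* Consider a splitting algorithm with threshold $D\ge2$, branching degree $G$, splitting measure $\mathcal{W}$ and cost $R_n$ (as defined in the context, under Assumption (A)). Let $(W_i)_{i\ge1}$ be an i.i.d. sequence of random variables with distribution $\mathcal{W}$ and, for $0<y<1$, let $$T(y)=\inf\Big\{i\ge1:\ \prod_{k=1}^{i}W_k<y\Big\}.$$ For $n\ge D$, let $U^D_{(n)}$ be the $D$th smallest of $n$ independent random variables uniformly distributed on $[0,1]$, independent of $(W_i)$. Then, for every $n\ge D$, $$\mathbb{E}(R_n)=1+\mathbb{E}(G)\,\mathbb{E}\left(\sum_{i=0}^{T(U^D_{(n)})-1}\frac{1}{\prod_{k=1}^{i}W_k}\right).$$
   Context: Splitting algorithm. Let $D\ge2$ be an integer, let $G$ be a random variable with values in $\{2,3,\ldots\}$, and for each $\ell\ge2$ let $V_\ell=(V_{1,\ell},\ldots,V_{\ell,\ell})$ be a random probability vector on $\{1,\ldots,\ell\}$ (nonnegative entries summing to $1$). Start with a set of $n$ items at the root of a tree. A node whose set has cardinality $<D$ is a leaf (the algorithm stops there). At a node with $m\ge D$ items, independently of everything else, draw a copy of $G$ and, given $G=\ell$, a copy of $V_\ell$; the node gets $\ell$ children, and, conditionally on $G=\ell$ and $V_\ell$, the numbers $(N_1,\ldots,N_\ell)$ of items sent to the children are multinomial with parameters $m$ and $(V_{1,\ell},\ldots,V_{\ell,\ell})$. The procedure is then applied to each child. The cost $R_n$ is the total number of nodes of the resulting tree. Thus $R_n=1$ for $n<D$, and for $n\ge D$, $R_n\stackrel{\text{dist.}}{=}1+R_{1,N_1}+\cdots+R_{G,N_G}$,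 where, given $G=\ell$, $V_\ell$ and $(N_i)$, the variables $R_{i,N_i}$ are independent and $R_{i,m}$ is distributed as $R_m$. Assumption (A). There is a constant $\delta\in(0,1)$ such that, almost surely, $\sup_{\ell\ge2}\sup_{1\le i\le \ell}V_{i,\ell}\le\delta$. Splitting measure. $\mathcal{W}$ is the probability distribution on $[0,1]$ defined, for nonnegative Borel $f$, by $$\int f(x)\,\mathcal{W}(dx)=\mathbb{E}\Big(\sum_{i=1}^{G}V_{i,G}f(V_{i,G})\Big)=\sum_{\ell\ge2}\sum_{i=1}^{\ell}\mathbb{P}(G=\ell)\,\mathbb{E}\big(V_{i,\ell}f(V_{i,\ell})\big).$$ The empty product equals $1$. Expectations are taken in $[0,+\infty]$. *)

(* Defs.v *)
From HB Require Import structures.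
From mathcomp Require Export all_boot all_order all_algebra.
From mathcomp Require Export all_classical all_reals all_analysis.
From mathcomp Require Export measurable_realfun.
Export Order.TTheory GRing.Theory Num.Theory.
Export numFieldNormedType.Exports.

Set Implicit Arguments.
Unset Strict Implicit.
Unset Printing Implicit Defensive.

Local Open Scope classical_set_scope.
Local Open Scope ring_scope.

(** * Independence *)

(* The product rule is required for every finite subfamily [s] of [I]; it
   makes the classes [F i] mutually independent as classes of events. *)
Definition mutually_independent d (T : measurableType d) (R : realType)
    (P : probability T R) (I : eqType) (F : I -> set (set T)) : Prop :=
  forall (s : seq I) (E : I -> set T), uniq s ->
    (forall i, i \in s -> F i (E i)) ->
    P (\bigcap_(i in [set i | i \in s]) E i) = (\prod_(i <- s) P (E i))%E.

Definition sigma_of d d' (T : measurableType d) (T' : measurableType d')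
    (X : T -> T') : set (set T) :=
  preimage_set_system setT X measurable.

(** * Parameters of the splitting algorithm *)

(* The branching degree [G0] and the vectors [V0 l] are given as random
   variables on an auxiliary probability space. Only the law of [G0] and the
   law of each [V0 l] are ever used, never their joint law. The coordinates
   of [V0 l] are indexed by 0, ..., l - 1. *)
Record splitting_parameters d (T : measurableType d) (R : realType)
    (P : probability T R) (G0 : {RV P >-> nat})
    (V0 : forall l : nat, 'I_l -> {RV P >-> R}) : Prop := {
  degree_ge2 : forall t, (2 <= G0 t)%N ;
  weight_ge0 : forall l, (2 <= l)%N -> forall (i : 'I_l) t, 0 <= V0 l i t ;
  weight_sum : forall l, (2 <= l)%N -> forall t, \sum_(i < l) V0 l i t = 1
}.

Definition assumption_A d (T : measurableType d) (R : realType)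
    (P : probability T R) (V0 : forall l : nat, 'I_l -> {RV P >-> R}) : Prop :=
  exists delta : R, 0 < delta < 1 /\
    {ae P, forall t, forall l, (2 <= l)%N -> forall i : 'I_l,
      V0 l i t <= delta}.

(* The splitting measure is carried by [0, 1] but is seen here as a law on
   the real line. *)
Definition is_splitting_measure d (T : measurableType d) (R : realType)
    (P : probability T R) (G0 : {RV P >-> nat})
    (V0 : forall l : nat, 'I_l -> {RV P >-> R}) (W : probability R R) : Prop :=
  forall f : R -> \bar R, measurable_fun [set: R] f -> (forall x, 0 <= f x)%E ->
    (\int[W]_x f x =
     \sum_(2 <= l <oo) \sum_(i < l)
       P (G0 @^-1` [set l]) *
       \int[P]_t ((V0 l i t)%:E * f (V0 l i t)))%E.

(** * The random tree *)

Definition multinomial_pmf (R : realType) (m l : nat) (v : 'I_l -> R)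
    (k : 'I_l -> nat) : R :=
  if (\sum_(i < l) k i == m)%N then
    (m`!)%:R / (\prod_(i < l) (k i)`!)%:R * \prod_(i < l) v i ^+ k i
  else 0.

(* Nodes are Ulam-Harris addresses written from the node up to the root:
   [::] is the root and [i :: u] is the child number [i] of [u], children
   being numbered from 0. Every potential address [u] carries a degree [G u],
   a weight vector [V u] (only its first [G u] coordinates matter) and, for
   each [m], the numbers [N u m i] of items that its [i]-th child receives in
   case [u] holds [m] items. *)
Section tree.
Variables (D n : nat) (g : seq nat -> nat) (N : seq nat -> nat -> nat -> nat).

Fixpoint items (u : seq nat) : nat :=
  if u is i :: v then N v (items v) i else n.

Fixpoint in_tree (u : seq nat) : bool :=
  if u is i :: v then [&& in_tree v, (D <= items v)%N & (i < g v)%N]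
  else true.

End tree.

Section realization.
Context d0 (T0 : measurableType d0) (R : realType) (P0 : probability T0 R).
Variables (G0 : {RV P0 >-> nat}) (V0 : forall l : nat, 'I_l -> {RV P0 >-> R}).
Context d (T : measurableType d) (P : probability T R).
Variables (D : nat) (G : seq nat -> {RV P >-> nat}).
Variables (V : seq nat -> nat -> {RV P >-> R}).
Variables (N : seq nat -> nat -> nat -> {RV P >-> nat}).

Definition node_sigma (u : seq nat) : set (set T) :=
  <<s sigma_of (G u)
      `|` \bigcup_i sigma_of (V u i)
      `|` \bigcup_m \bigcup_i sigma_of (N u m i) >>.

(* [node_law] is the joint law, on a generating family of rectangles, of the
   degree, the weights and the item counts at a node holding [m >= D] items:
   the degree is a copy of [G0]; given that it is [l], the weights are a copy
   of [V0 l]; given both, the counts are multinomial. *)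
Record splitting_realization : Prop := {
  node_law : forall u m l (B : 'I_l -> set R) (k : 'I_l -> nat),
    (D <= m)%N -> (forall i, measurable (B i)) ->
    P [set t | G u t = l /\ (forall i : 'I_l, B i (V u i t)) /\
               (forall i : 'I_l, N u m i t = k i)] =
    (P0 (G0 @^-1` [set l]) *
     \int[P0]_(t in [set t | forall i : 'I_l, B i (V0 i t)])
       (multinomial_pmf m (fun i : 'I_l => V0 i t) k)%:E)%E ;
  node_indep : mutually_independent P node_sigma
}.

Definition cost (n : nat) (t : T) : \bar R :=
  counting [set u | in_tree D n (fun u => G u t) (fun u m i => N u m i t) u].

End realization.

(** * Products of the splitting measure and order statistics *)

(* [w k] is the (k+1)-st term of the sequence; the value is +oo when the set
   is empty. *)
Definition crossing_time (R : realType) (w : nat -> R) (y : R) : \bar R :=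
  ereal_inf [set i%:R%:E | i in [set i | (1 <= i)%N /\
                                         \prod_(k < i) w k < y]].

(* The [r]-th smallest value, for [1 <= r <= n]. *)
Definition order_statistic (R : realType) (n r : nat) (x : 'I_n -> R) : R :=
  nth 0 (sort <=%R [seq x j | j <- enum 'I_n]) r.-1.

(* Main.v *)
(* Given the weights, a node at address u holds Binomial(n, V_u) items,
   V_u being the product of the weights along u, so the mean number of level-j nodes
   holding m >= D items is the sum over the addresses u of length j of
   E [b(n, V_u; m)], and size biasing at each level (weights become independent
   W_k with density 1/W_k) turns it into E [b(n, Pi_j; m) / Pi_j] with
   Pi_j = W_1 ... W_j.  This is proved by induction on j: both sides satisfy the
   same recursion, on one side because a node is independent of its past and the
   multinomial has binomial marginals, on the other by binomial thinning.
   Summing over m >= D gives E [1{U <= Pi_j} / Pi_j] because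
   P(U <= p) = P(Bin(n, p) >= D), and U <= Pi_j is the event j < T(U).  Finally the
   mean number of children of an internal node is E(G), by independence. *)

From mathcomp Require Import finmap ring.
Require Import Defs.

Set Implicit Arguments.
Unset Strict Implicit.
Unset Printing Implicit Defensive.
Local Open Scope classical_set_scope.
Local Open Scope ring_scope.

(** * Countable sums *)

Section countable_sums.
Context (R : realType).
Local Open Scope ereal_scope.

(** Enumerating the type by [pickle] gives an ordinary series, to which monotone convergence and
    scaling of series apply. *)
Lemma esum_countType (I : countType) (a : I -> \bar R) : (forall i, 0 <= a i) ->
  \esum_(i in [set: I]) a i =
  \sum_(k <oo) (if pickle_inv k is Some i then a i else 0).
Proof.
move=> a0; rewrite nneseries_esumT; last by move=> k; case: (pickle_inv k).
have inj : set_inj [set: I] (@pickle I) by move=> x y _ _; exact: (pcan_inj pickleK).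
transitivity (\esum_(k in @pickle I @` [set: I])
  (if @pickle_inv I k is Some i then a i else 0)).
  by rewrite esum_image//; apply: eq_esum => i _; rewrite pickleK_inv.
rewrite esum_mkcond; apply: eq_esum => k _; case: ifPn => // kI.
have := @pickle_invK I k; case: (pickle_inv k) => //= i ik.
by move/negP: kI; case; rewrite inE; exists i.
Qed.

Lemma integral_esum d (T : measurableType d) (mu : {measure set T -> \bar R})
    (I : countType) (f : I -> T -> \bar R) :
  (forall i, measurable_fun [set: T] (f i)) -> (forall i t, 0 <= f i t) ->
  \int[mu]_t (\esum_(i in [set: I]) f i t) =
  \esum_(i in [set: I]) \int[mu]_t f i t.
Proof.
move=> mf f0; rewrite esum_countType; last by move=> i; exact: integral_ge0.
under eq_integral do rewrite esum_countType//.
rewrite integral_nneseries//; last 2 first.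
  by move=> k; case: (pickle_inv k).
  by move=> k t _; case: (pickle_inv k).
by apply: eq_eseriesr => k _; case: (pickle_inv k) => //; rewrite integral0.
Qed.

Lemma measurable_esum d (T : measurableType d)
    (I : countType) (f : I -> T -> \bar R) :
  (forall i, measurable_fun [set: T] (f i)) -> (forall i t, 0 <= f i t) ->
  measurable_fun [set: T] (fun t => \esum_(i in [set: I]) f i t).
Proof.
move=> mf f0; under eq_fun do rewrite esum_countType//.
apply: ge0_emeasurable_sum => [k t _ _|k _]; by case: (pickle_inv k).
Qed.

(** Total probability: at each t only the fibre over [X t] contains t. As [I] carries no
    sigma-algebra, measurability is asked of the fibres inside [E] and not of [X]. *)
Lemma probability_esum_fiber d (T : measurableType d) (P : probability T R)
    (I : countType) (X : T -> I) (E : set T) : measurable E ->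
  (forall i, measurable (E `&` [set t | X t = i])) ->
  P E = \esum_(i in [set: I]) P (E `&` [set t | X t = i]).
Proof.
move=> mE mX.
transitivity (\int[P]_t (\esum_(i in [set: I]) (\1_(E `&` [set s | X s = i]) t)%:E)).
  rewrite -[E in LHS]setIT -integral_indic//; apply: eq_integral => t _.
  transitivity (\esum_(i in [set X t]) (\1_(E `&` [set s | X s = i]) t)%:E : \bar R).
    rewrite esum_set1 ?lee_fin//; congr (_%:E).
    rewrite !indicE; congr (nat_of_bool _)%:R; apply/idP/idP; rewrite !inE//=.
    by case.
  rewrite esum_mkcond; apply: eq_esum => i _; case: ifPn => //.
  rewrite notin_setE/= => /eqP iX; rewrite indicE memNset//= => -[_ Xi].
  by rewrite Xi eqxx in iX.
rewrite integral_esum => [|i|i t]; last by rewrite lee_fin.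
- by apply: eq_esum => i _; rewrite integral_indic// setIT.
- by apply/measurable_EFinP; exact: measurable_indic.
Qed.

(** The factor may be +oo: this covers the case where E(G) is infinite. *)
Lemma esumZl (I : countType) (Q : set I) (x : \bar R) (a : I -> \bar R) :
  (forall i, 0 <= a i) -> 0 <= x ->
  \esum_(i in Q) (x * a i) = x * (\esum_(i in Q) a i).
Proof.
wlog -> : Q a / Q = setT.
  move=> H a0 x0; rewrite esum_mkcond [in RHS]esum_mkcond -H//; last first.
    by move=> i; case: ifP.
  by apply: eq_esum => i _; case: ifP; rewrite ?mule0.
move=> a0; case: x => [x| |//] x0.
  rewrite esum_countType; last by move=> i; exact: mule_ge0.
  rewrite esum_countType// -nneseriesZl//; last by move=> k _; case: (pickle_inv k).
  by apply: eq_eseriesr => k _; case: (pickle_inv k) => //; rewrite mule0.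
(* The factor is +oo here: either every term vanishes, or one positive term makes both sides
   infinite. *)
have [a_eq0|/existsNP[i /eqP ai]] := pselect (forall i, a i = 0).
  by rewrite !esum1 ?mule0// => i _; rewrite a_eq0 ?mule0.
have ai_gt0 : 0 < a i by rewrite lt0e ai a0.
have le_ai (b : I -> \bar R) : (forall j, 0 <= b j) ->
    b i <= \esum_(j in [set: I]) b j.
  move=> b0; apply: esum_ge; exists [set i]; last by rewrite fsbig_set1.
  by split => //; exact: finite_set1.
rewrite [RHS]gt0_mulye; last exact: lt_le_trans ai_gt0 (le_ai _ a0).
apply/eqP; rewrite eq_le leey/=.
apply: le_trans (le_ai (fun i => +oo * a i) _); first by rewrite gt0_mulye.
by move=> j; exact: mule_ge0.
Qed.

Lemma esum_swap (I J : choiceType) (A : set I) (B : set J) (a : I -> J -> \bar R) :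
  (forall i j, 0 <= a i j) ->
  \esum_(i in A) \esum_(j in B) a i j = \esum_(j in B) \esum_(i in A) a i j.
Proof.
move=> a0; rewrite !esum_esum//.
rewrite (reindex_esum (B `*`` (fun=> A)) _ (fun x => (x.2, x.1)))//.
split=> //=; first by move=> [j i] [].
  by move=> [i j] [j' i'] _ _ /= [-> ->].
by move=> [i j] [/= Ai Bj]; exists (j, i).
Qed.

End countable_sums.

(** * Integrals of functions that agree almost everywhere *)

Section ae_eq_integral.
Import HBNNSimple.

(* Without measurability: outside the almost sure event where all W k lie in ]0, 1],
   the terms of the series in the theorem may be negative. *)
Lemma ae_eq_integral_nonmeasurable d (T : measurableType d) (R : realType)
    (mu : {measure set T -> \bar R}) (f g : T -> \bar R) :
  {ae mu, forall t, f t = g t} -> (\int[mu]_t f t = \int[mu]_t g t)%E.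
Proof.
move=> [N [mN N0 fgN]].
have fg t : ~ N t -> f t = g t.
  by move=> Nt; apply: contrapT => fgt; exact/Nt/fgN.
have mNC : measurable (~` N) by exact: measurableC.
pose nni (a : T -> \bar R) := ereal_sup [set sintegral mu h |
  h in [set h : {nnsfun T >-> R} | forall x, ((h x)%:E <= a x)%E]].
suff H (a b : T -> \bar R) : (forall t, 0 <= b t)%E ->
    (forall t, ~ N t -> a t = b t) -> (nni a <= nni b)%E.
  rewrite /integral !patch_setT; congr (_ - _)%E; apply/eqP; rewrite eq_le;
    apply/andP; split; apply: H => // t Nt; rewrite ?funeposE ?funenegE fg//.
move=> b0 ab; apply: ge_ereal_sup => _ [h /= hf <-].
(* Restricting a simple function below [a] to the complement of the null set [N] puts it below [b]
   and keeps its integral. *)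
apply: ereal_sup_ubound => /=; exists (proj_nnsfun h mNC) => [t|].
  rewrite /= mindicE; have [/set_mem Nt|Nt] := boolP (t \in ~` N).
    by rewrite mulr1 -ab.
  by rewrite mulr0.
rewrite -!integralT_nnsfun; apply: ge0_ae_eq_integral => //.
- by apply/measurable_EFinP.
- by apply/measurable_EFinP.
- by move=> t _; rewrite lee_fin.
- by move=> t _; rewrite lee_fin.
exists N; split => // t /= ht; apply: contrapT => Nt; apply: ht => _.
by rewrite mindicE mem_set// mulr1.
Qed.
End ae_eq_integral.

(** * Independence *)

Section independence.
Context d (T : measurableType d) (R : realType) (P : probability T R).
Local Open Scope ereal_scope.

Section grouping.
Variables (I : choiceType) (F : I -> set (set T)).
Hypothesis mF : forall i A, F i A -> measurable A.
Hypothesis FT : forall i, F i setT.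
Hypothesis FI : forall i, setI_closed (F i).
Hypothesis indepF : mutually_independent P F.

Let cylinders (S : set I) : set (set T) :=
  [set A | exists s : seq I, exists E : I -> set T,
    [/\ uniq s, forall i, i \in s -> S i, forall i, F i (E i) &
        A = \bigcap_(i in [set i | i \in s]) E i]].

Let cylindersI S : setI_closed (cylinders S).
Proof.
move=> _ _ [s1 [E1 [_ S1 F1 ->]]] [s2 [E2 [_ S2 F2 ->]]].
(* Padding with [setT] lets both families be indexed by the union of the two lists. *)
pose E i := (if i \in s1 then E1 i else setT) `&` (if i \in s2 then E2 i else setT).
exists (undup (s1 ++ s2)), E; split.
- exact: undup_uniq.
- by move=> i; rewrite mem_undup mem_cat => /orP[/S1|/S2].
- by move=> i; apply: FI; case: ifP.
- apply/seteqP; split => [t [h1 h2] i _|t h].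
    by split; case: ifPn => // ?; [exact: h1|exact: h2].
  split => i /= is_; have := h i; rewrite /= mem_undup mem_cat is_ ?orbT => /(_ isT).
    by case; rewrite is_.
  by case; rewrite is_.
Qed.

(** Pi-lambda argument: for fixed B, the sets A satisfying the product rule form a Dynkin system,
    and the finite intersections over S form a pi-system generating the sigma-algebra. *)
Lemma independent_group (S : set I) (k : I) (A B : set T) : ~ S k ->
  <<s \bigcup_(i in S) F i >> A -> F k B -> P (A `&` B) = P A * P B.
Proof.
move=> Sk SA FB; have mB := mF FB.
pose H := [set A | measurable A /\ P (A `&` B) = P A * P B].
have cylS : <<s \bigcup_(i in S) F i >> `<=` <<s cylinders S >>.
  apply: smallest_sub; first exact: smallest_sigma_algebra.
  move=> C [i Si FC]; apply: sub_sigma_algebra.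
  exists [:: i], (fun j => if j == i then C else setT); split => //.
  - by move=> j; rewrite inE => /eqP ->.
  - by move=> j; case: eqVneq => [->|].
  - apply/seteqP; split => [t Ct j /=|t /(_ i)]; first by rewrite inE => ->.
    by rewrite /= inE eqxx; exact.
suff HS : <<s cylinders S >> `<=` H by have [] := HS _ (cylS _ SA).
apply: lambda_system_subset => //.
- apply/dynkin_lambda_system; split.
  + by split => //; rewrite setTI probability_setT mul1e.
  + move=> X [mX PX]; split; first exact: measurableC.
    rewrite setIC -setDE measureD//; last by rewrite ltey_eq fin_num_measure.
    rewrite (setIC B X) [X in _ - X](_ : _ = P X * P B)//.
    by rewrite probability_setC// muleBl ?fin_num_measure// mul1e.
  + move=> X tX HX; have mX n : measurable (X n) := (HX n).1.
    split; first exact: bigcup_measurable.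
    rewrite setI_bigcupl measure_bigcup//; last 2 first.
    * by move=> n _; exact: measurableI.
    * exact: trivIset_setIr.
    rewrite measure_bigcup// [RHS]muleC -(fineK (fin_num_measure P B mB)).
    rewrite -nneseriesZl//.
    by apply: eq_eseriesr => n _; rewrite fineK ?fin_num_measure// muleC; exact: (HX n).2.
- move=> _ [s [E [us sS FE ->]]]; split.
    by apply: fin_bigcap_measurable => [|i _]; [exact: finite_seq|exact: mF (FE i)].
  have ks : k \notin s by apply/negP => /sS.
  (* Since k is not in s, B can be inserted at index k, and the product rule is applied to both
     [k :: s] and [s]. *)
  pose E' i := if i == k then B else E i.
  have FE' i : F i (E' i) by rewrite /E'; case: eqVneq => [->|].
  have -> : (\bigcap_(i in [set i | i \in s]) E i) `&` B =
      \bigcap_(i in [set i | i \in k :: s]) E' i.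
    apply/seteqP; split => [t [Et Bt] i /=|t Et].
      rewrite inE /E'; case: eqVneq => // _ /=; exact: Et.
    split; last by have := Et k; rewrite /E' /= inE eqxx; apply.
    move=> i /= si; have := Et i; rewrite /= inE si orbT /E' => /(_ isT).
    by case: eqVneq => // ik; move: ks; rewrite -ik si.
  rewrite indepF ?indepF//= ?ks// big_cons /E' eqxx muleC; congr (_ * _).
  rewrite !big_seq; apply: eq_bigr => i si; case: eqVneq => // ik.
  by move: ks; rewrite -ik si.
Qed.
End grouping.

(** The joint law of (X, Y) agrees with the product of the laws on rectangles, hence everywhere;
    Tonelli then gives the iterated integral. *)
Lemma integral_indep d1 d2 (T1 : measurableType d1) (T2 : measurableType d2)
    (X : T -> T1) (Y : T -> T2) (f : T1 * T2 -> \bar R) :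
  measurable_fun setT X -> measurable_fun setT Y ->
  (forall A B, measurable A -> measurable B ->
     P (X @^-1` A `&` Y @^-1` B) = P (X @^-1` A) * P (Y @^-1` B)) ->
  measurable_fun setT f -> (forall z, 0 <= f z) ->
  \int[P]_t f (X t, Y t) = \int[P]_s \int[P]_t f (X t, Y s).
Proof.
move=> mX mY XY mf f0.
pose X' : {RV P >-> T1} := mfun_Sub (mem_set mX).
pose Y' : {RV P >-> T2} := mfun_Sub (mem_set mY).
have mXY : measurable_fun setT (fun t => (X t, Y t)) by exact: measurable_fun_pair.
pose XY' : {RV P >-> (T1 * T2)%type} := mfun_Sub (mem_set mXY).
transitivity (\int[distribution P XY']_z f z).
  by rewrite ge0_integral_distribution.
transitivity (\int[distribution P X' \x distribution P Y']_z f z).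
  apply: eq_measure_integral => A mA _; apply/esym.
  apply: product_measure_unique => // B C mB mC; exact: XY.
rewrite fubini_tonelli2//.
rewrite ge0_integral_distribution; last 2 first.
- exact: measurable_fun_fubini_tonelli_G.
- by move=> y; exact: integral_ge0.
apply: eq_integral => s _ /=; rewrite /fubini_G ge0_integral_distribution//.
exact: measurableT_comp.
Qed.
End independence.

(** * Order statistics *)

Lemma esum_finType (R : realType) (I : finType) (a : I -> \bar R) :
  (forall i, 0 <= a i)%E -> \esum_(i in [set: I]) a i = (\sum_i a i)%E.
Proof.
move=> a0; rewrite esum_fset; [|exact: finite_finset|by []].
have -> : [set: I] = [set` index_enum I].
  by apply/seteqP; split => // i _; rewrite /= mem_index_enum.
by rewrite -fsbig_seq ?index_enum_uniq.
Qed.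

(** Sorting preserves the count, and in a sorted list the entries at most y form an initial
    segment. *)
Lemma nth_sort_le (R : realType) (s : seq R) (r : nat) (y : R) :
  (0 < r <= size s)%N ->
  (nth 0 (sort <=%R s) r.-1 <= y) = (r <= count (<= y) s)%N.
Proof.
case: r => // r /= rs; rewrite -(count_sort <=%R).
have := sort_le_sorted s; have : (r < size (sort <=%R s))%N by rewrite size_sort.
move: (sort _ s) => {rs}s rs sorts.
apply/idP/idP => [rle|].
  rewrite -[s in count _ s](cat_take_drop r.+1) count_cat.
  have : all (<= y) (take r.+1 s).
    apply/(all_nthP 0) => i; rewrite size_take_min ltn_min => /andP[ir ilt].
    rewrite nth_take//; apply: le_trans rle.
    by apply: le_sorted_leq_nth => //; rewrite inE.
  by rewrite all_count size_takel// => /eqP ->; rewrite leq_addr.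
apply: contraLR; rewrite -ltNge -ltnNge ltnS => ylt.
rewrite -[s in count _ s](cat_take_drop r) count_cat.
have : ~~ has (<= y) (drop r s).
  rewrite -all_predC; apply/(all_nthP 0) => i; rewrite size_drop ltn_subRL => ilt.
  rewrite nth_drop /= -ltNge; apply: lt_le_trans ylt _.
  by apply: le_sorted_leq_nth; rewrite ?inE ?leq_addr.
rewrite has_count -eqn0Ngt => /eqP ->; rewrite addn0.
by apply: leq_trans (count_size _ _) _; rewrite size_take_min geq_minl.
Qed.

Lemma order_statistic_le (R : realType) (n r : nat) (x : 'I_n -> R) (y : R) :
  (0 < r <= n)%N ->
  (order_statistic r x <= y) = (r <= #|[set j | (x j <= y)%R]%SET|)%N.
Proof.
move=> rn; rewrite /order_statistic nth_sort_le; last by rewrite size_map -cardE card_ord.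
rewrite count_map -size_filter cardE; congr (_ <= _)%N; congr size.
by rewrite enumT; apply: eq_filter => j /=; rewrite inE.
Qed.

(** The subsets are grouped by cardinality, with 'C(n, m) of them of size m. *)
Lemma sum_bernoulli_sets (R : realType) (n r : nat) (p : R) :
  \sum_(J : {set 'I_n} | (r <= #|J|)%N) p ^+ #|J| * (1 - p) ^+ (n - #|J|) =
  \sum_(r <= m < n.+1) binomial_pmf n p m.
Proof.
have leJ (J : {set 'I_n}) : (#|J| <= n)%N by rewrite -[leqRHS]card_ord max_card.
rewrite (big_nat_widenl _ 0)// big_mkord.
rewrite (partition_big (fun J : {set 'I_n} => inord #|J| : 'I_n.+1)
  (fun m : 'I_n.+1 => (r <= m)%N)) /=; last first.
  by move=> J rJ; rewrite inordK// ltnS.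
apply: eq_bigr => m rm; rewrite /binomial_pmf /unstable.onem.
transitivity (\sum_(J in [set J : {set 'I_n} | #|J| == m]%SET)
  (p ^+ m * (1 - p) ^+ (n - m))); last by rewrite sumr_const card_draws card_ord.
have inordE (J : {set 'I_n}) : (inord #|J| == m) = (#|J| == m).
  by rewrite -val_eqE/= inordK// ltnS.
apply: eq_big => J; rewrite ?inE inordE; last by move=> /andP[_ /eqP ->].
by case: eqP => [->|]; rewrite ?andbT ?andbF.
Qed.

Lemma uniform_prob_itvNyc (R : realType) (p : R) : 0 <= p <= 1 ->
  uniform_prob (@ltr01 R) `]-oo, p] = p%:E.
Proof.
move=> /andP[p0 p1]; rewrite /uniform_prob integral_uniform_pdf.
have -> : `]-oo, p] `&` `[0, 1] = `[0, p]%classic :> set R.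
  apply/seteqP; split => x /=; rewrite !in_itv/=; first by move=> [? /andP[->]].
  by move=> /andP[-> xp]; split=> //; exact: le_trans xp p1.
rewrite (eq_integral (cst 1%E)).
  by rewrite integral_cst//= lebesgue_measure_itv/= lte_fin mul1e;
    case: ltgtP p0 => // [p0 _|<-]; rewrite ?sube0.
move=> x; rewrite inE/= in_itv/= /uniform_pdf => /andP[x0 xp].
by rewrite x0 (le_trans xp p1) subr0 invr1.
Qed.

Section order_statistic.
Context d (T : measurableType d) (R : realType) (P : probability T R).
Variables (D n : nat) (U : 'I_n -> {RV P >-> R}).
Hypothesis Dn : (0 < D <= n)%N.

Let below y t : {set 'I_n} := [set j | (U j t <= y)%R]%SET.

(** This writes the event as an intersection of one event per variable, the form to which mutual
    independence applies. *)
Let belowE y J : [set t | below y t = J] = \bigcap_(j in [set j | j \in enum 'I_n])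
   U j @^-1` (if j \in J then `]-oo, y]%classic else ~` `]-oo, y]%classic).
Proof.
apply/seteqP; split => [t <- j _|t tJ] /=.
  by rewrite inE; case: ifPn => h /=; rewrite in_itv//=; exact/negP.
apply/setP => j; have := tJ j; rewrite /= mem_enum => /(_ isT).
rewrite inE; case: ifPn => jJ /=; rewrite in_itv//=; last by move/negP/negbTE.
Qed.

Let measurable_below y J : measurable [set t | below y t = J].
Proof.
rewrite belowE; apply: fin_bigcap_measurable => [|j _]; first exact: finite_seq.
rewrite -[X in measurable X]setTI; apply: measurable_funPT => //.
by case: ifP => _ //; exact: measurableC.
Qed.

Let measurable_order_statistic_le y :
  measurable [set t | order_statistic D (fun j => U j t) <= y].
Proof.
have -> : [set t | order_statistic D (fun j => U j t) <= y] =
    \bigcup_(J in [set J : {set 'I_n} | (D <= #|J|)%N]) [set t | below y t = J].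
  apply/seteqP; split => [t|t [J /= DJ tJ]] /=; rewrite order_statistic_le//.
    by move=> Dt; exists (below y t).
  by rewrite -/(below y t) tJ.
by apply: fin_bigcup_measurable => // J _; exact: measurable_below.
Qed.

Lemma measurable_order_statistic :
  measurable_fun [set: T] (fun t => order_statistic D (fun j => U j t)).
Proof.
apply: (measurability (@RGenOInfty.G R)) => [|_ [_ [y ->] <-]].
  exact: RGenOInfty.measurableE.
rewrite setTI (_ : _ @^-1` _ = ~` [set t | order_statistic D (fun j => U j t) <= y]).
  exact/measurableC/measurable_order_statistic_le.
by apply/seteqP; split => t /=; rewrite in_itv/= andbT ltNge => /negP.
Qed.

(** The event is split along the random set J of indices j with U_j at most p. By independence each
    J has probability p^|J| (1 - p)^(n - |J|), and exactly the J with at least D elements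
    contribute. *)
Lemma order_statistic_cdf (p : R) : 0 <= p <= 1 ->
  (forall j A, measurable A -> distribution P (U j) A = uniform_prob (@ltr01 R) A) ->
  mutually_independent P (fun j => sigma_of (U j)) ->
  P [set t | order_statistic D (fun j => U j t) <= p] =
  (\sum_(D <= m < n.+1) binomial_pmf n p m)%:E.
Proof.
move=> p01 Udist Uindep; rewrite -sum_bernoulli_sets -sumEFin.
rewrite (probability_esum_fiber P (X := below p)) => [| |J]; last 2 first.
- exact: measurable_order_statistic_le.
- by apply: measurableI => //; exact: measurable_order_statistic_le.
rewrite esum_finType// [RHS]big_mkcond; apply: eq_bigr => J _.
have -> : [set t | order_statistic D (fun j => U j t) <= p] `&`
    [set t | below p t = J] = if (D <= #|J|)%N then [set t | below p t = J] else set0.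
  case: ifPn => DJ; apply/seteqP; split => t //=; rewrite order_statistic_le//.
  - by case.
  - by move=> tJ; rewrite -/(below p t) tJ.
  - by rewrite -/(below p t) => -[+ tJ]; rewrite tJ; apply/negP.
case: ifPn => // _; rewrite belowE; apply: etrans (Uindep _ _ (enum_uniq _) _) _.
  move=> j _; exists (if j \in J then `]-oo, p]%classic else ~` `]-oo, p]%classic);
    rewrite ?setTI//.
  by case: ifP => _ //; exact: measurableC.
transitivity (\prod_(j <- enum 'I_n) (if j \in J then p else (1 - p))%:E)%E.
  have UE j : P (U j @^-1` `]-oo, p]) = p%:E.
    by rewrite -uniform_prob_itvNyc//; exact: (Udist j _ (measurable_itv _)).
  apply: eq_bigr => j _; case: ifP => _; first exact: UE.
  rewrite preimage_setC EFinB -(UE j); rewrite probability_setC//.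
  exact: (measurable_funPTI (U j) (measurable_itv `]-oo, p])).
rewrite prodEFin big_enum/= (bigID (mem J))/=; congr (_ * _)%:E.
  by rewrite -prodr_const; apply: eq_bigr => j ->.
rewrite (eq_bigr (fun=> (1 - p))) => [|j /negbTE ->//].
rewrite (eq_bigl (mem (~: J)%SET)) => [|j]; last by rewrite !inE.
by rewrite prodr_const cardsCs finset.setCK card_ord.
Qed.
End order_statistic.

(** * Multinomial and binomial laws *)

Lemma esum_support (R : realType) (I J : choiceType) (e : I -> J) (a : J -> \bar R) :
  injective e -> (forall j, ~ range e j -> a j = 0%E) ->
  \esum_(j in [set: J]) a j = \esum_(i in [set: I]) a (e i).
Proof.
move=> einj a0; rewrite -(esum_image setT e); last by move=> x y _ _; exact: einj.
rewrite [RHS]esum_mkcond; apply: eq_esum => j _; case: ifPn => //.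
by rewrite notin_setE => /a0.
Qed.

Section multinomial.
Variables (R : realType) (l m : nat) (v : 'I_l -> R).

(** The exponential series of (v i) X, truncated at degree m because only coefficients up to X^m are
    read. *)
Let expp i : {poly R} := \poly_(a < m.+1) (v i ^+ a / a`!%:R).

Let fact_neq0 k : k`!%:R != 0 :> R.
Proof. by rewrite pnatr_eq0 -lt0n fact_gt0. Qed.

Let coef_prod_expp (Q : pred 'I_l) k : (k <= m)%N ->
  (\prod_(i | Q i) expp i)`_k = (\sum_(i | Q i) v i) ^+ k / k`!%:R.
Proof.
(* [K p x] says that p agrees with exp(x X) up to degree m. By the binomial theorem, multiplying p
   by [expp i] corresponds to adding [v i] to x. *)
pose K (p : {poly R}) (x : R) := forall k, (k <= m)%N -> p`_k = x ^+ k / k`!%:R.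
move: k; change (K (\prod_(i | Q i) expp i) (\sum_(i | Q i) v i)).
apply: big_rec2 => [k _|i x p _ IH k km].
  by rewrite coef1 expr0n; case: k => [|k]; rewrite /= ?mul0r// fact0 divr1.
rewrite coefM addrC exprDn mulr_suml; apply: eq_bigr => -[j /= jk] _.
rewrite ltnS in jk; rewrite coef_poly ltnS (leq_trans jk km).
rewrite IH ?(leq_trans (leq_subr _ _) km)// -mulr_natr -(bin_fact jk) !natrM.
by field; rewrite !fact_neq0 pnatr_eq0 -lt0n bin_gt0 jk.
Qed.

(** Exponential generating functions: the sum is m! times the coefficient of X^m in a product where
    the factor at [i0] is reduced to its term of degree r. The other factors multiply to exp((1 - v
    i0) X) up to degree m. *)
Lemma multinomial_marginal (i0 : 'I_l) (r : nat) : \sum_(i < l) v i = 1 ->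
  \sum_(f : {ffun 'I_l -> 'I_m.+1})
    (if f i0 == r :> nat then multinomial_pmf m v (fun i => f i) else 0) =
  binomial_pmf m (v i0) r.
Proof.
move=> v1.
(* Zeroing the coefficients at [i0] in degrees other than r turns the constraint on [f i0] into a
   product form, so that the sum over f distributes. *)
pose c i a : R := if (i == i0) && (a != r) then 0 else v i ^+ a / a`!%:R.
have cE (f : {ffun 'I_l -> 'I_m.+1}) :
    (if f i0 == r :> nat then multinomial_pmf m v (fun i => f i) else 0) =
    m`!%:R * (\prod_i (c i (f i) *: 'X^(f i)))`_m.
  rewrite scaler_prod prodrXr coefZ coefXn /multinomial_pmf [m == _]eq_sym.
  case: ifPn => fr.
    have -> : \prod_i c i (f i) = (\prod_i (f i)`!%:R)^-1 * \prod_i v i ^+ f i.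
      rewrite mulrC -prodf_div; apply: eq_bigr => i _; rewrite /c.
      by case: eqVneq => //= ->; rewrite fr.
    by case: ifP => _; rewrite ?mulr0// mulr1 natr_prod mulrA.
  rewrite (bigD1 i0)//= /c eqxx fr/= !mul0r mulr0//.
under eq_bigr do rewrite cE.
rewrite -mulr_sumr -coef_sum -(bigA_distr_bigA (fun i (a : 'I_m.+1) => c i a *: 'X^a)).
rewrite (bigD1 i0)//=.
have -> : \prod_(i | i != i0) \sum_(a < m.+1) c i a *: 'X^a = \prod_(i | i != i0) expp i.
  apply: eq_bigr => i ii0; rewrite /expp poly_def.
  by apply: eq_bigr => a _; rewrite /c (negbTE ii0).
have sumv : \sum_(i | i != i0) v i = 1 - v i0.
  by rewrite -v1 [in RHS](bigD1 i0)//= addrAC subrr add0r.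
rewrite /binomial_pmf /unstable.onem; have [rm|mr] := leqP r m; last first.
  rewrite bin_small// mulr0n big1 ?mul0r ?coef0 ?mulr0// => a _.
  by rewrite /c eqxx ltn_eqF ?scale0r// (leq_trans (ltn_ord a)).
have -> : \sum_(a < m.+1) c i0 a *: 'X^a = (v i0 ^+ r / r`!%:R) *: 'X^r.
  rewrite (bigD1 (Ordinal (rm : (r < m.+1)%N)))//= {1}/c eqxx/= eqxx/=.
  rewrite big1 ?addr0// => a ar; rewrite /c eqxx/= ifT ?scale0r//.
rewrite -scalerAl coefZ coefXnM ltnNge rm/= coef_prod_expp ?leq_subr// sumv.
rewrite -mulr_natr -(bin_fact rm) !natrM; field.
by rewrite !fact_neq0.
Qed.

Lemma esum_multinomial_marginal (i0 : 'I_l) (r : nat) :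
  (forall i, 0 <= v i) -> \sum_(i < l) v i = 1 ->
  \esum_(k in [set: {ffun 'I_l -> nat}])
    (if k i0 == r then multinomial_pmf m v k else 0)%:E =
  (binomial_pmf m (v i0) r)%:E.
Proof.
move=> v0 v1; rewrite -multinomial_marginal// -sumEFin.
pose e (f : {ffun 'I_l -> 'I_m.+1}) : {ffun 'I_l -> nat} := [ffun i => f i : nat].
have pmf0 k : 0 <= multinomial_pmf m v k.
  rewrite /multinomial_pmf; case: ifP => // _.
  by rewrite mulr_ge0 ?divr_ge0 ?prodr_ge0// => i _; exact: exprn_ge0.
rewrite (@esum_support _ _ _ e).
- rewrite esum_finType; last by move=> f; case: ifP; rewrite lee_fin.
  apply: eq_bigr => f _; rewrite ffunE; case: ifP => // _; congr (_%:E).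
  by congr (multinomial_pmf m v); apply/funext => i; rewrite ffunE.
- move=> f g /ffunP fg; apply/ffunP => i; apply/val_inj.
  by have := fg i; rewrite !ffunE.
- move=> k ke; case: ifP => // _; rewrite /multinomial_pmf; case: eqP => // km.
  exfalso; apply: ke; have kle i : (k i < m.+1)%N.
    by rewrite ltnS -km (bigD1 i)//= leq_addr.
  by exists [ffun i => Ordinal (kle i)] => //; apply/ffunP => i; rewrite !ffunE.
Qed.

End multinomial.

(** Terms with k < m vanish. With k = j + m, the identity C(n, k) C(k, m) = C(n, m) C(n - m, j)
    leaves the expansion of ((1 - p) + p (1 - w))^(n - m), whose base is 1 - p w. *)
Lemma binomial_pmf_thin (R : realType) (n m : nat) (p w : R) :
  \sum_(k < n.+1) binomial_pmf n p k * binomial_pmf k w m =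
  binomial_pmf n (p * w) m.
Proof.
rewrite /binomial_pmf /unstable.onem; have [mn|nm] := leqP m n; last first.
  rewrite (bin_small nm) mulr0n big1// => k _.
  by rewrite (@bin_small k m) ?mulr0n ?mulr0// (leq_trans (ltn_ord k)).
rewrite -(big_mkord xpredT (fun k => (p ^+ k * (1 - p) ^+ (n - k) *+ 'C(n, k)) *
  (w ^+ m * (1 - w) ^+ (k - m) *+ 'C(k, m)))).
rewrite (big_cat_nat (n := m))//=; last exact: leqW.
rewrite big_nat_cond big1 ?add0r; last first.
  by move=> k /andP[/andP[_ km] _]; rewrite (bin_small km) mulr0n mulr0.
rewrite -{1}[m]add0n big_addn big_mkord subSn//.
have -> : 1 - p * w = (1 - p) + p * (1 - w) by ring.
rewrite exprDn mulr_sumr -sumrMnl; apply: eq_bigr => -[j /= jnm] _.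
rewrite ltnS in jnm; have jmn : (j + m <= n)%N by rewrite addnC -leq_subRL.
have binR a b : (b <= a)%N -> 'C(a, b)%:R = a`!%:R / (b`!%:R * (a - b)`!%:R) :> R.
  move=> ba; rewrite -(bin_fact ba) !natrM mulfK// mulf_neq0//;
  by rewrite pnatr_eq0 -lt0n fact_gt0.
rewrite -[RHS]mulr_natr -[_ *+ 'C(n, j + m)]mulr_natr -[_ *+ 'C(j + m, m)]mulr_natr.
rewrite -[_ *+ 'C(n - m, j)]mulr_natr !binR ?leq_addl// addnK exprD !exprMn.
rewrite subnDA (subnAC n j m).
have fact_neq0 k : k`!%:R != 0 :> R by rewrite pnatr_eq0 -lt0n fact_gt0.
by field; rewrite !fact_neq0.
Qed.

(** * One node *)

Lemma esum_indic_ltn (R : realType) (n : nat) :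
  \esum_(i in [set: nat]) (i < n)%N%:R%:E = n%:R%:E :> \bar R.
Proof.
rewrite (esum_support (e := @nat_of_ord n)).
- rewrite esum_finType => [|i]; last by rewrite lee_fin.
  under eq_bigr do rewrite ltn_ord.
  by rewrite sumEFin sumr_const card_ord.
- exact: val_inj.
- move=> j jn; case: ltnP => // jn'; exfalso; apply: jn.
  by exists (Ordinal jn').
Qed.

Lemma counting_esum (R : realType) (I : choiceType) (A : set I) :
  counting A = \esum_(i in [set: I]) (i \in A)%:R%:E :> \bar R.
Proof.
have -> : \esum_(i in [set: I]) (i \in A)%:R%:E = \esum_(i in A) 1%E :> \bar R.
  by rewrite [RHS]esum_mkcond; apply: eq_esum => i _; case: ifP.
rewrite /counting; case: asboolP => [finA|infA].
  rewrite esum_fset// fsbig_finite//= sumEFin; congr (_%:E).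
  by rewrite big_const_seq count_predT iter_addr_0.
(* An infinite set contains a finite set of at least [Num.bound x] elements, so the sum exceeds any
   real x. *)
apply/esym/eqyP => x x0; have [B BA xB] := infinite_set_fset (Num.bound x) infA.
apply: esum_ge; exists [set` B] => //.
rewrite fsbig_finite//= set_fsetK sumEFin lee_fin.
rewrite big_const_seq count_predT iter_addr_0; apply: le_trans (ltW (archi_boundP (ltW x0))) _.
by rewrite ler_nat.
Qed.

Lemma measurable_inv (R : realType) : measurable_fun [set: R] (@GRing.inv R).
Proof.
rewrite -(setvU [set (0 : R)]); apply/measurable_funU => //; first exact: measurableC.
split; last exact: measurable_fun_set1.
apply: open_continuous_measurable_fun; first exact/closed_openC/closed_eq.
move=> x x0; by apply: inv_continuous; apply/eqP/(set_mem x0).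
Qed.

(* The density, with respect to the splitting measure, of the mean number of
   children holding [m] items of a node holding [k]; it vanishes at [w = 0]. *)
Definition child_kernel (R : realType) (k m : nat) (w : R) : R :=
  if 0 <= w <= 1 then binomial_pmf k w m / w else 0.

Section child_kernel.
Variable R : realType.
Implicit Types w : R.

Lemma child_kernel_ge0 k m w : 0 <= child_kernel k m w.
Proof.
rewrite /child_kernel; case: ifP => // w01.
by rewrite divr_ge0 ?binomial_pmf_ge0//; case/andP: w01.
Qed.

Lemma measurable_child_kernel k m : measurable_fun [set: R] (child_kernel k m).
Proof.
apply: measurable_fun_ifT => //.
  by apply: measurable_and; exact: measurable_fun_ler.
apply: measurable_funM; first exact: measurable_binomial_pmf.
exact: measurable_inv.
Qed.

(** The size-biasing factor w of the splitting measure cancels the density 1/w. At w = 0 both sides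
    vanish, the right one because m > 0. *)
Lemma mul_child_kernel k m w : (0 < m)%N -> 0 <= w <= 1 ->
  w * child_kernel k m w = binomial_pmf k w m.
Proof.
move=> m0 w01; rewrite /child_kernel w01; have [->|w0] := eqVneq w 0.
  by rewrite mul0r /binomial_pmf expr0n gtn_eqF// mul0r mul0rn.
by rewrite mulrC divfK.
Qed.
End child_kernel.

Lemma esum_binomial_pmf (R : realType) (m : nat) (p : R) : 0 <= p <= 1 ->
  \esum_(r in [set: nat]) (binomial_pmf m p r)%:E = 1%E.
Proof.
move=> p01; rewrite (esum_support (e := @nat_of_ord m.+1)).
- rewrite esum_finType => [|r]; last by rewrite lee_fin binomial_pmf_ge0.
  rewrite sumEFin; congr (_%:E).
  transitivity ((1 - p + p) ^+ m); last by rewrite subrK expr1n.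
  by rewrite exprDn; apply: eq_bigr => r _; rewrite /binomial_pmf mulrC.
- exact: val_inj.
- move=> r rm; rewrite /binomial_pmf bin_small//.
  by rewrite ltnNge; apply/negP => rm'; apply: rm; exists (Ordinal (rm' : (r < m.+1)%N)).
Qed.

Section node.
Context d0 (T0 : measurableType d0) (R : realType) (P0 : probability T0 R).
Variables (G0 : {RV P0 >-> nat}) (V0 : forall l : nat, 'I_l -> {RV P0 >-> R}).
Hypothesis params : splitting_parameters G0 V0.
Context d (T : measurableType d) (P : probability T R).
Variables (D : nat) (G : seq nat -> {RV P >-> nat}).
Variables (V : seq nat -> nat -> {RV P >-> R}).
Variables (N : seq nat -> nat -> nat -> {RV P >-> nat}).
Hypothesis alg : splitting_realization G0 V0 D G V N.
Local Open Scope ereal_scope.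

Let multinomial_ge0 l m k t : (2 <= l)%N ->
  (0 <= multinomial_pmf m (fun i : 'I_l => V0 i t) k)%R.
Proof.
move=> l2; rewrite /multinomial_pmf; case: ifP => // _.
rewrite mulr_ge0 ?divr_ge0 ?prodr_ge0// => i _.
by apply: exprn_ge0; apply: (weight_ge0 params).
Qed.

Let measurable_multinomial l m k :
  measurable_fun setT (fun t => multinomial_pmf m (fun i : 'I_l => V0 i t) k).
Proof.
rewrite /multinomial_pmf; case: (\sum_(i < l) k i == m)%N => //.
apply: measurable_funM => //; apply: (measurable_prod (h := fun i t => V0 i t ^+ k i)%R) => i _.
exact: measurable_funX.
Qed.

Lemma degree_law_lt2 l : (l < 2)%N -> P0 (G0 @^-1` [set l]) = 0.
Proof.
move=> l2; rewrite (_ : _ @^-1` _ = set0) ?measure0//.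
apply/seteqP; split => // t /= Gl; move: (degree_ge2 params t).
by rewrite Gl leqNgt l2.
Qed.

Lemma weight_le1 l (i : 'I_l) t : (2 <= l)%N -> (0 <= V0 i t <= 1)%R.
Proof.
move=> l2; rewrite (weight_ge0 params)//= -(weight_sum params l2 t) (bigD1 i)//=.
by rewrite lerDl sumr_ge0// => j _; exact: (weight_ge0 params).
Qed.

Lemma measurable_preimage_nat d' (T' : measurableType d') (P' : probability T' R)
  (X : {RV P' >-> nat}) (Q : nat -> Prop) : measurable [set t | Q (X t)].
Proof. by rewrite -[X in measurable X]setTI; exact: (measurable_funP X). Qed.

(** The node law, with the weights left free, is summed over all vectors of counts whose i-th entry
    is r; the multinomial law then reduces to its binomial marginal. *)
Lemma node_marginal u m l (i : 'I_l) r : (D <= m)%N ->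
  P [set t | G u t = l /\ N u m i t = r] =
  P0 (G0 @^-1` [set l]) * \int[P0]_t (binomial_pmf m (V0 i t) r)%:E.
Proof.
move=> Dm; pose X t : {ffun 'I_l -> nat} := [ffun j : 'I_l => N u m j t].
have mX k : measurable [set t | X t = k].
  rewrite (_ : mkset _ = \bigcap_(j in [set: 'I_l]) [set t | N u m j t = k j]).
    by apply: fin_bigcap_measurable => // j _; exact: (measurable_preimage_nat _ (eq^~ (k j))).
  apply/seteqP; split => [t <- j _ /=|t tk]; first by rewrite ffunE.
  by apply/ffunP => j; rewrite ffunE; exact: (tk j).
have mE : measurable [set t | G u t = l /\ N u m i t = r].
  by apply: measurableI; [exact: (measurable_preimage_nat _ (eq^~ l))|
    exact: (measurable_preimage_nat _ (eq^~ r))].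
rewrite (probability_esum_fiber P (X := X) mE); last by move=> k; exact: measurableI.
have fiberE k : P ([set t | G u t = l /\ N u m i t = r] `&` [set t | X t = k]) =
    P0 (G0 @^-1` [set l]) * \int[P0]_t
      (if k i == r then multinomial_pmf m (fun j : 'I_l => V0 j t) k else 0%R)%:E.
  case: eqP => [kr|kr]; last first.
    rewrite integral0_eq ?mule0//.
    rewrite (_ : _ `&` _ = set0) ?measure0//.
    by apply/seteqP; split => // t /= [[_ Nr] Xk]; apply: kr; rewrite -Xk ffunE.
  have := node_law alg u (l := l) (B := fun=> setT) k Dm (fun=> measurableT).
  rewrite (_ : [set t | forall i : 'I_l, _] = setT); last exact/seteqP.
  move=> <-; congr (P _); apply/seteqP; split => t /=.
    by move=> [[-> _] <-]; split => //; split => // j; rewrite ffunE.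
  move=> [-> [_ Nk]]; split; first by rewrite Nk.
  by apply/ffunP => j; rewrite ffunE Nk.
under eq_esum do rewrite fiberE.
(* [V0 l] is known to be a probability vector only for l at least 2; smaller degrees have
   probability 0. *)
have [l2|l2] := ltnP l 2.
  by rewrite degree_law_lt2// mul0e esum1// => k _; rewrite mul0e.
rewrite esumZl//; last first.
  by move=> k; apply: integral_ge0 => t _; case: ifP; rewrite lee_fin// multinomial_ge0.
rewrite -integral_esum; last 2 first.
- by move=> k; apply/measurable_EFinP; case: (k i == r).
- by move=> k t; case: ifP; rewrite lee_fin// multinomial_ge0.
congr (_ * _); apply: eq_integral => t _; apply: esum_multinomial_marginal.
  by move=> j; exact: (weight_ge0 params).
exact: (weight_sum params).
Qed.
(** The degree is reached through its joint law with the count of one child at m = D, and that count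
    is summed out. The bound i < l provides the child. *)
Lemma degree_law u (l i : nat) : (i < l)%N ->
  P [set t | G u t = l] = P0 [set t | G0 t = l].
Proof.
move=> il; have mG : measurable [set t | G u t = l] := measurable_preimage_nat _ (eq^~ l).
rewrite (probability_esum_fiber P (X := N u D i) mG); last first.
  by move=> r; apply: measurableI => //; exact: (measurable_preimage_nat _ (eq^~ r)).
transitivity (\esum_(r in [set: nat]) P0 (G0 @^-1` [set l]) *
    \int[P0]_t (binomial_pmf D (V0 (Ordinal il) t) r)%:E).
  by apply: eq_esum => r _; exact: (node_marginal u (Ordinal il)).
have [l2|l2] := ltnP l 2.
  by rewrite esum1 => [|r _]; rewrite -/(G0 @^-1` [set l]) degree_law_lt2// mul0e.
have pmf0 r t : 0 <= (binomial_pmf D (V0 (Ordinal il) t) r)%:E.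
  by rewrite lee_fin binomial_pmf_ge0// weight_le1.
rewrite esumZl//; last by move=> r; exact: integral_ge0.
rewrite -integral_esum//; last first.
  move=> r; apply/measurable_EFinP.
  exact: (measurableT_comp (measurable_binomial_pmf (D := setT) D r)).
under eq_integral do rewrite esum_binomial_pmf ?weight_le1//.
by rewrite integral_cst//= probability_setT !mule1.
Qed.

(** Tail-sum formula for E(G). Each tail is split over the degrees l > i, for which child i exists
    and [degree_law] applies. *)
Lemma esum_degree u :
  \esum_(i in [set: nat]) P [set t | (i < G u t)%N] = \int[P0]_t (G0 t)%:R%:E.
Proof.
under eq_integral do rewrite -esum_indic_ltn.
rewrite integral_esum; last 2 first.
- move=> i; apply/measurable_EFinP.
  exact: (measurableT_comp (f := fun k => (i < k)%N%:R : R)).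
- by move=> i t; rewrite lee_fin.
apply: eq_esum => i _.
have -> : \int[P0]_t (i < G0 t)%:R%:E = P0 [set t | (i < G0 t)%N].
  rewrite -[X in P0 X]setIT -integral_indic//.
    by apply: eq_integral => t _; rewrite indicE mem_setE.
  exact: (measurable_preimage_nat G0 (fun k => i < k)%N).
have fiberE d' (T' : measurableType d') (P' : probability T' R) (X : {RV P' >-> nat}) :
    P' [set t | (i < X t)%N] =
    \esum_(l in [set: nat]) (if (i < l)%N then P' [set t | X t = l] else 0).
  rewrite (probability_esum_fiber P' (X := X) (measurable_preimage_nat X (fun k => i < k)%N)).
    apply: eq_esum => l _; case: ifPn => il; last rewrite -(measure0 P').
      by congr (P' _); apply/seteqP; split => t /=; [case|move=> ->].
    by congr (P' _); apply/seteqP; split => t //= -[+ tl]; rewrite tl (negbTE il).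
  move=> l; apply: measurableI; first exact: (measurable_preimage_nat X (fun k => i < k)%N).
  exact: (measurable_preimage_nat X (eq^~ l)).
apply: etrans (fiberE _ _ P (G u)) _; apply/esym; apply: etrans (fiberE _ _ P0 G0) _.
by apply: eq_esum => l _; case: ifP => // il; rewrite -(degree_law u il).
Qed.

Variable W : probability R R.
Hypothesis Wlaw : is_splitting_measure G0 V0 W.

(* Size biasing removes the atom at 0. *)
Lemma splitting_measure_support : W (~` `]0%R, 1%R]) = 0.
Proof.
have mS : measurable (~` `]0%R, 1%R] : set R) by exact: measurableC.
rewrite -[X in W X]setIT -integral_indic// Wlaw; last 2 first.
- exact/measurable_EFinP.
- by move=> w; rewrite lee_fin.
apply: eseries0 => l _ _; apply: big1 => i _; have [l2|l2] := ltnP l 2.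
  by rewrite degree_law_lt2// mul0e.
rewrite integral0_eq ?mule0// => t _; rewrite indicE.
have /andP[v0 v1] := weight_le1 i t l2.
have [->|vn0] := eqVneq (V0 i t) 0%R; first by rewrite mul0e.
rewrite memNset ?mule0//; apply; rewrite /= in_itv/=.
by rewrite v1 lt0r vn0 v0.
Qed.

(** Splitting over the degree l and exchanging sums leaves, for each l, the binomial marginals of
    its l children. This is the defining series of the splitting measure tested on
    [child_kernel]. *)
Lemma esum_child_kernel u k m : (D <= k)%N -> (0 < m)%N ->
  \esum_(i in [set: nat]) P [set t | (i < G u t)%N /\ N u k i t = m] =
  \int[W]_w (child_kernel k m w)%:E.
Proof.
move=> Dk m0; pose a i l := P [set t | G u t = l /\ N u k i t = m].
have mE i l : measurable [set t | G u t = l /\ N u k i t = m].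
  by apply: measurableI; [exact: (measurable_preimage_nat _ (eq^~ l))|
    exact: (measurable_preimage_nat _ (eq^~ m))].
transitivity (\esum_(i in [set: nat]) \esum_(l in [set: nat])
    (if (i < l)%N then a i l else 0)).
  apply: eq_esum => i _.
  have mI : measurable [set t | (i < G u t)%N /\ N u k i t = m].
    apply: measurableI; first exact: (measurable_preimage_nat _ (fun j => i < j)%N).
    exact: (measurable_preimage_nat _ (eq^~ m)).
  rewrite (probability_esum_fiber P (X := G u) mI) => [|l]; last first.
    by apply: measurableI => //; exact: (measurable_preimage_nat _ (eq^~ l)).
  apply: eq_esum => l _; case: ifPn => il; last rewrite -(measure0 P).
    by congr (P _); apply/seteqP; split => t /=; [move=> [[_ ->] ->]|move=> [-> ->]].
  by congr (P _); apply/seteqP; split => t //= -[[+ _] tl]; rewrite tl (negbTE il).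
rewrite esum_swap; last by move=> i l; case: ifP => //; rewrite measure_ge0.
transitivity (\esum_(l in [set: nat]) \sum_(i < l) a i l).
  apply: eq_esum => l _; rewrite (esum_support (e := @nat_of_ord l)).
  - rewrite esum_finType => [|i]; last by rewrite ltn_ord measure_ge0.
    by apply: eq_bigr => i _; rewrite ltn_ord.
  - exact: val_inj.
  - move=> i il; case: ifP => // il'; exfalso; apply: il.
    by exists (Ordinal il').
rewrite -nneseries_esumT; last by move=> l; apply: sume_ge0 => i _; exact: measure_ge0.
(* The series defining the splitting measure starts at l = 2; the terms l = 0, 1 are null. *)
rewrite (nneseries_split 0 2); last by move=> l _; apply: sume_ge0 => i _; exact: measure_ge0.
rewrite big_nat_cond big1 ?add0e; last first.
  move=> l /andP[/andP[_ l2] _]; apply: big1 => i _.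
  by rewrite /a node_marginal ?degree_law_lt2 ?mul0e.
rewrite Wlaw; last 2 first.
- by apply/measurable_EFinP; exact: measurable_child_kernel.
- by move=> w; rewrite lee_fin child_kernel_ge0.
apply: eq_eseriesr => l _; apply: eq_bigr => i _.
rewrite /a node_marginal//; have [l2|l2] := ltnP l 2.
  by rewrite degree_law_lt2// !mul0e.
by congr (_ * _); apply: eq_integral => t _; rewrite -EFinM mul_child_kernel// weight_le1.
Qed.


End node.

(** * The tree *)

Lemma esum_seq_level (R : realType) (T : choiceType) (j : nat) (f : seq T -> \bar R) :
  (forall u, 0 <= f u)%E ->
  \esum_(u in [set u | size u = j.+1]) f u =
  \esum_(v in [set v | size v = j]) \esum_(i in [set: T]) f (i :: v).
Proof.
move=> f0; rewrite esum_esum//.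
rewrite (reindex_esum ([set v | size v = j] `*`` (fun=> setT)) _ (fun x => x.2 :: x.1))//.
split.
- by move=> [v i] [/= <-].
- by move=> [v i] [v' i'] _ _ /= [-> ->].
- by move=> [//|i v] [/= vj]; exists (v, i).
Qed.

Lemma esum_seq_levels (R : realType) (T : choiceType) (f : seq T -> \bar R) :
  (forall u, 0 <= f u)%E ->
  \esum_(u in [set: seq T]) f u =
  \esum_(j in [set: nat]) \esum_(u in [set u | size u = j]) f u.
Proof.
move=> f0; rewrite -esum_bigcupT//.
  by congr esum; apply/seteqP; split => // u _; exists (size u).
by move=> i j _ _ [u [/= <- <-]].
Qed.

Lemma esum_seq_recl (R : realType) (T : choiceType) (f : seq T -> \bar R) :
  (forall u, 0 <= f u)%E ->
  (\esum_(u in [set: seq T]) f u =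
   f [::] + \esum_(v in [set: seq T]) \esum_(i in [set: T]) f (i :: v))%E.
Proof.
move=> f0; rewrite (esumID [set [::]])//; congr (_ + _)%E.
  by rewrite setTI esum_set1.
rewrite esum_esum// setTI.
rewrite (reindex_esum ([set: seq T] `*`` (fun=> setT)) _ (fun x => x.2 :: x.1))//.
split.
- by move=> [v i].
- by move=> [v i] [v' i'] _ _ /= [-> ->].
- by move=> [|i v] u0; [case: u0|exists (v, i)].
Qed.

Lemma sigma_algebraI (T : pointedType) (C : set (set T)) (A B : set T) :
  <<s C >> A -> <<s C >> B -> <<s C >> (A `&` B).
Proof. exact: (@measurableI _ (g_sigma_algebraType C)). Qed.

Section tree.
Context d0 (T0 : measurableType d0) (R : realType) (P0 : probability T0 R).
Variables (G0 : {RV P0 >-> nat}) (V0 : forall l : nat, 'I_l -> {RV P0 >-> R}).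
Hypothesis params : splitting_parameters G0 V0.
Context d (T : measurableType d) (P : probability T R).
Variables (D : nat) (G : seq nat -> {RV P >-> nat}).
Variables (V : seq nat -> nat -> {RV P >-> R}).
Variables (N : seq nat -> nat -> nat -> {RV P >-> nat}).
Hypothesis alg : splitting_realization G0 V0 D G V N.
Variable n : nat.
Local Open Scope ereal_scope.

Let held t u := items n (fun u m i => N u m i t) u.
Let node t u := in_tree D n (fun u => G u t) (fun u m i => N u m i t) u.
Let occupied u m := [set t | node t u /\ held t u = m].

Lemma node_sigma_measurable u A : node_sigma G V N u A -> measurable A.
Proof.
move: A; apply: smallest_sub.
  split; [exact: measurable0|by move=> A mA; rewrite setTD; exact: measurableC|].
  by move=> A mA; exact: bigcup_measurable.
move=> A [[[B mB <-]|[i _ [B mB <-]]]|[m _ [i _ [B mB <-]]]];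
  exact: measurable_funP.
Qed.

(** Both variables are discrete, so any condition on them is a countable union of intersections of
    generators. *)
Lemma node_sigma_count u m i (Q : nat -> nat -> Prop) :
  node_sigma G V N u [set t | Q (G u t) (N u m i t)].
Proof.
have -> : [set t | Q (G u t) (N u m i t)] = \bigcup_k \bigcup_l
    (if `[< Q k l >] then [set t | G u t = k] `&` [set t | N u m i t = l] else set0).
  apply/seteqP; split => t /=.
    by move=> q; exists (G u t) => //; exists (N u m i t) => //; rewrite asboolT.
  by move=> [k _ [l _]]; case: asboolP => // q [/= -> ->].
apply: sigma_algebra_bigcup => k; apply: sigma_algebra_bigcup => l.
case: ifP => _; last exact: sigma_algebra0.
apply: sigma_algebraI; apply: sub_sigma_algebra.
  by left; left; exists [set k] => //; rewrite setTI.
by right; exists m => //; exists i => //; exists [set l] => //; rewrite setTI.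
Qed.

(** The past of u is taken to be all shorter addresses: it contains the ancestors and excludes u, as
    grouping requires. *)
Lemma independent_past u A B :
  <<s \bigcup_(v in [set v | (size v < size u)%N]) node_sigma G V N v >> A ->
  node_sigma G V N u B -> P (A `&` B) = P A * P B.
Proof.
apply: (independent_group (F := node_sigma G V N)).
- exact: node_sigma_measurable.
- by move=> v; rewrite -[setT]setD0; apply: sigma_algebraCD; exact: sigma_algebra0.
- by move=> v A' B'; exact: sigma_algebraI.
- exact: (node_indep alg).
- by rewrite /= ltnn.
Qed.

(** Fixing the parent's count k replaces the random index of [N v] by a constant, so that the second
    event depends on the data of v alone. *)
Let occupied_cons i v m : occupied (i :: v) m =
  \bigcup_(k in [set k | (D <= k)%N])
    (occupied v k `&` [set t | (i < G v t)%N /\ N v k i t = m]).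
Proof.
apply/seteqP; split => t.
  by move=> [/and3P[tv Dv iG] vm]; exists (held t v).
move=> [k /= Dk [[tv vk] [iG Nm]]]; split; last by rewrite /held/= -/(held t v) vk.
by rewrite /node/= -/(held t v) -/(node t v) tv vk Dk iG.
Qed.

Let occupied_sigma u m :
  <<s \bigcup_(v in [set v | (size v < size u)%N]) node_sigma G V N v >> (occupied u m).
Proof.
elim: u m => [|i v IH] m.
  have [nm|nm] := eqVneq n m.
    rewrite (_ : occupied _ _ = setT `\` set0); last by rewrite setD0; apply/seteqP; split.
    by apply: sigma_algebraCD; exact: sigma_algebra0.
  rewrite (_ : occupied _ _ = set0); first exact: sigma_algebra0.
  by apply/seteqP; split => // t [_ /= nm']; move: nm; rewrite -nm' eqxx.
rewrite occupied_cons [X in <<s _ >> X]bigcup_mkcond; apply: sigma_algebra_bigcup => k.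
case: ifP => _; last exact: sigma_algebra0.
apply: sigma_algebraI.
  have := IH k; apply: sub_sigma_algebra2 => A [w /= wv nA].
  by exists w => //=; exact: leq_trans wv (leqnSn _).
apply: sub_sigma_algebra; exists v => /=; first by [].
exact: (node_sigma_count k i (fun a b => (i < a)%N /\ b = m)).
Qed.

Let measurable_occupied u m : measurable (occupied u m).
Proof.
have := @occupied_sigma u m; move: (occupied u m); apply: smallest_sub.
  split; [exact: measurable0|by move=> A mA; rewrite setTD; exact: measurableC|].
  by move=> A mA; exact: bigcup_measurable.
by move=> A [v _]; exact: node_sigma_measurable.
Qed.

Let measurable_child v k i m : measurable [set t | (i < G v t)%N /\ N v k i t = m].
Proof.
exact: (node_sigma_measurable (node_sigma_count k i (fun a b => (i < a)%N /\ b = m))).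
Qed.

Let measurable_held u k : measurable [set t | held t u = k].
Proof.
elim: u k => [|i v IH] k.
  rewrite /held/=; have [->|nk] := eqVneq n k.
    by rewrite (_ : mkset _ = setT)//; apply/seteqP; split.
  by rewrite (_ : mkset _ = set0)//; apply/seteqP; split => // t /= /eqP; rewrite (negbTE nk).
rewrite (_ : mkset _ = \bigcup_j ([set t | held t v = j] `&` [set t | N v j i t = k])).
  apply: bigcupT_measurable => j; apply: measurableI => //.
  exact: (node_sigma_measurable (node_sigma_count j i (fun a b => b = k))).
apply/seteqP; split => [t|t [j _ [/= vj Nk]]]; first by exists (held t v).
by rewrite /held/= -/(held t v) vj.
Qed.

(** Whether v holds k items is decided by strictly shorter addresses, and how it splits by the data
    of v, so the two are independent. For k < D the node v is a leaf and the fibre is empty. *)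
Lemma occupied_cons_prob i v m : P (occupied (i :: v) m) =
  \esum_(k in [set k | (D <= k)%N])
    (P (occupied v k) * P [set t | (i < G v t)%N /\ N v k i t = m]).
Proof.
rewrite (probability_esum_fiber P (X := held ^~ v)); [|by []|]; last first.
  by move=> k; exact: measurableI.
rewrite [RHS]esum_mkcond; apply: eq_esum => k _.
case: ifPn => [/set_mem/= Dk|/negP Dk].
  rewrite -(independent_past (u := v)); last 2 first.
  - exact: occupied_sigma.
  - exact: (node_sigma_count k i (fun a b => (i < a)%N /\ b = m)).
  congr (P _); apply/seteqP; split => t.
    rewrite occupied_cons => -[[j _ [[tv <-] [iG Nm]]] /= vk].
    by rewrite vk in Nm; do !split.
  move=> [[tv vk] [iG Nm]]; split => //; rewrite occupied_cons.
  by exists k => //; rewrite -vk.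
rewrite -(measure0 P); congr (P _); apply/seteqP; split => // t.
by rewrite occupied_cons => -[[j Dj [[_ vj] _]] vk]; apply/Dk/mem_set; rewrite -vk vj.
Qed.

Definition level_mean j m := \esum_(u in [set u : seq nat | size u = j]) P (occupied u m).

Lemma level_mean0 m : level_mean 0 m = (n == m)%:R%:E.
Proof.
rewrite /level_mean (_ : [set u | _] = [set [::]]); last first.
  by apply/seteqP; split => u /=; [case: u|move=> ->].
rewrite esum_set1//; have [nm|nm] := eqVneq n m.
  by rewrite -(@probability_setT _ _ _ P); congr (P _); apply/seteqP; split.
rewrite -[RHS](measure0 P); congr (P _); apply/seteqP; split => // t [_ /= nm'].
by rewrite -nm' eqxx in nm.
Qed.

Variable W : probability R R.
Hypothesis Wlaw : is_splitting_measure G0 V0 W.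

(** The mean number of children with m items of a node holding k does not depend on its address v,
    so it factors out of the sum over level j. *)
Lemma level_meanS j m : (0 < m)%N -> level_mean j.+1 m =
  \esum_(k in [set k | (D <= k)%N])
    (level_mean j k * \int[W]_w (child_kernel k m w)%:E).
Proof.
move=> m0; rewrite /level_mean esum_seq_level//.
transitivity (\esum_(v in [set v : seq nat | size v = j]) \esum_(k in [set k | (D <= k)%N])
   (\int[W]_w (child_kernel k m w)%:E * P (occupied v k))).
  apply: eq_esum => v _; under eq_esum do rewrite occupied_cons_prob.
  rewrite esum_swap; last by move=> i k; exact: mule_ge0.
  apply: eq_esum => k /= Dk; rewrite esumZl// muleC; congr (_ * _).
  exact: (esum_child_kernel params alg Wlaw).
rewrite esum_swap; last first.
  move=> v k; apply: mule_ge0 => //.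
  by apply: integral_ge0 => w _; rewrite lee_fin child_kernel_ge0.
apply: eq_esum => k _; rewrite esumZl// 1?muleC//.
by apply: integral_ge0 => w _; rewrite lee_fin child_kernel_ge0.
Qed.

(** Every node except the root is a child of a node v holding at least D items. The degree of v is
    independent of its occupation, so summing over child numbers gives the factor E(G). *)
Lemma mean_cost : \int[P]_t cost D G N n t =
  1 + (\int[P0]_t (G0 t)%:R%:E) *
    (\esum_(j in [set: nat]) \esum_(m in [set m | (D <= m)%N]) level_mean j m).
Proof.
have mnode u : measurable [set t | node t u].
  rewrite (_ : mkset _ = \bigcup_k occupied u k).
    by apply: bigcupT_measurable.
  by apply/seteqP; split => [t ut|t [k _ []]]//; exists (held t u).
have -> : \int[P]_t cost D G N n t = \esum_(u in [set: seq nat]) P [set t | node t u].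
  transitivity (\int[P]_t \esum_(u in [set: seq nat]) (\1_[set t | node t u] t)%:E).
    apply: eq_integral => t _; rewrite /cost counting_esum; apply: eq_esum => u _.
    by rewrite indicE !mem_setE.
  rewrite integral_esum; [|by move=> u; exact/measurable_EFinP|by move=> u t; rewrite lee_fin].
  by apply: eq_esum => u _; rewrite integral_indic// setIT.
rewrite esum_seq_recl//; congr (_ + _).
  by rewrite -[RHS](probability_setT P); congr (P _); apply/seteqP; split.
have childE v i : P [set t | node t (i :: v)] =
    (\esum_(k in [set k | (D <= k)%N]) P (occupied v k)) * P [set t | (i < G v t)%N].
  rewrite (probability_esum_fiber P (X := held ^~ v)); [|by []|]; last first.
    by move=> k; exact: measurableI.
  rewrite muleC -esumZl// [RHS]esum_mkcond; apply: eq_esum => k _.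
  case: ifPn => [/set_mem/= Dk|/negP Dk].
    rewrite muleC -(independent_past (u := v)); last 2 first.
    - exact: occupied_sigma.
    (* The event involves the degree only, so the indices 0 0 of the count are arbitrary. *)
    - exact: (node_sigma_count 0 0 (fun a b => (i < a)%N)).
    congr (P _); apply/seteqP; split => t.
      by move=> [/and3P[tv _ iG] vk].
    move=> [[tv vk] iG]; split => //=.
    by rewrite /node/= -/(held t v) -/(node t v) tv vk Dk.
  rewrite -(measure0 P); congr (P _); apply/seteqP; split => // t.
  by move=> [/and3P[_ Dv _] vk]; apply/Dk/mem_set; rewrite -vk.
transitivity (\esum_(v in [set: seq nat])
   ((\int[P0]_t (G0 t)%:R%:E) * \esum_(k in [set k | (D <= k)%N]) P (occupied v k))).
  apply: eq_esum => v _; under eq_esum do rewrite childE.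
  by rewrite esumZl ?(esum_degree params alg) 1?muleC// esum_ge0.
rewrite esumZl; [|by move=> v; exact: esum_ge0|exact: integral_ge0].
congr (_ * _); rewrite esum_seq_levels; last by move=> v; exact: esum_ge0.
by apply: eq_esum => j _; rewrite esum_swap.
Qed.

End tree.

(** * Products of the splitting measure *)

(** The infimum ranges over indices at least 1, hence the shift to [j.+1]; for i = 0 the condition
    is empty, in accordance with T >= 1. An infinite crossing time is included. *)
Lemma le_crossing_time (R : realType) (w : nat -> R) (y : R) (i : nat) :
  (i%:R%:E <= crossing_time w y - 1)%E = [forall j : 'I_i, y <= \prod_(k < j.+1) w k].
Proof.
rewrite leeBrDr// -EFinD natr1; apply/idP/idP => [h|/forallP h].
  apply/forallP => j; rewrite leNgt; apply/negP => jy.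
  have : (crossing_time w y <= (j.+1)%:R%:E)%E.
    by apply: ereal_inf_lbound; exists j.+1.
  by move/(le_trans h); rewrite lee_fin ler_nat ltnS leqNgt ltn_ord.
apply: le_ereal_inf_tmp => _ [j [j1 jy] <-]; rewrite lee_fin ler_nat.
rewrite ltnNge; apply/negP => ji; case: j => // j in j1 jy ji *.
by have := h (Ordinal ji); rewrite /= leNgt jy.
Qed.

(** Binomial thinning divided by p w; terms with k > n vanish. *)
Lemma child_kernel_thin (R : realType) (n m : nat) (p w : R) : (0 < m)%N ->
  0 < p <= 1 -> 0 < w <= 1 ->
  \esum_(k in [set: nat]) (child_kernel n k p * child_kernel k m w)%:E =
  (child_kernel n m (p * w))%:E.
Proof.
move=> m0 /andP[p0 p1] /andP[w0 w1].
have pw : 0 <= p * w <= 1.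
  by apply/andP; split; [rewrite mulr_ge0// ltW|rewrite mulr_ile1// ltW].
rewrite (esum_support (e := @nat_of_ord n.+1)).
- rewrite esum_finType => [|k]; last by rewrite lee_fin mulr_ge0 ?child_kernel_ge0.
  rewrite sumEFin /child_kernel pw (ltW p0) p1 (ltW w0) w1 /=; congr (_%:E).
  rewrite -binomial_pmf_thin mulr_suml; apply: eq_bigr => k _.
  by rewrite mulf_div.
- exact: val_inj.
- move=> k kn; rewrite /child_kernel /binomial_pmf (@bin_small n k).
    by rewrite mulr0n mul0r if_same mul0r.
  by rewrite ltnNge; apply/negP => kn'; apply: kn; exists (Ordinal (kn' : (k < n.+1)%N)).
Qed.

Section products.
Context d (T : measurableType d) (R : realType) (P : probability T R).
Variables (W : nat -> {RV P >-> R}) (Y : T -> R).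
Hypothesis mY : measurable_fun setT Y.
Hypothesis indepWY : mutually_independent P
  (fun k : option nat => if k is Some k then sigma_of (W k) else sigma_of Y).
Variable Wlaw : probability R R.
Hypothesis Wdist : forall k (A : set R), measurable A ->
  distribution P (W k) A = Wlaw A.
Hypothesis W01 : Wlaw (~` `]0, 1]) = 0%E.
Local Open Scope ereal_scope.

Let Pi j t : R := (\prod_(k < j) W k t)%R.

Let F (k : option nat) := if k is Some k then sigma_of (W k) else sigma_of Y.

Let sigma_ofI (Z : T -> R) : setI_closed (sigma_of Z).
Proof.
move=> _ _ [A mA <-] [B mB <-]; exists (A `&` B); first exact: measurableI.
by rewrite !setTI preimage_setI.
Qed.

Lemma measurable_prodW j : measurable_fun setT (Pi j).
Proof. by apply: (measurable_prod (h := fun (k : 'I_j) t => W k t)). Qed.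

(** The product of the first j weights is measurable for the sigma-algebra they generate. The index
    [k] covers both uses: a later weight ([Some i]) and Y ([None]). *)
Lemma independent_prodW j k A B :
  (if k is Some i then (j <= i)%N else true) -> measurable A -> F k B ->
  P (Pi j @^-1` A `&` B) = P (Pi j @^-1` A) * P B.
Proof.
move=> jk mA FB.
apply: (@independent_group _ _ _ P _ F _ _ _ _
  [set i | if i is Some i then (i < j)%N else False] k) => //.
- move=> [i|] C [D mD <-]; first exact: measurable_funP.
  exact: mY.
- by move=> [i|]; exists setT => //; rewrite setTI.
- by move=> [i|]; exact: sigma_ofI.
- by case: k jk {FB} => [i ji|_] //=; rewrite ltnNge ji.
pose C := \bigcup_(i in [set i | if i is Some i then (i < j)%N else False]) F i.
have mPi : measurable_fun [set: g_sigma_algebraType C] (Pi j).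
  apply: (measurable_prod (h := fun (k : 'I_j) (t : g_sigma_algebraType C) => W k t)) => i _ _ D mD.
  by apply: sub_sigma_algebra; exists (Some (i : nat)) => //=; exists D.
by have := mPi measurableT _ mA; rewrite setTI.
Qed.

Lemma ae_W01 : {ae P, forall t, forall k, (0 < W k t <= 1)%R}.
Proof.
apply: ae_foralln => k; exists (W k @^-1` (~` `]0%R, 1%R])); split.
- rewrite -[X in measurable X]setTI; apply: measurable_funP => //.
  exact: measurableC.
- by rewrite -W01 -(Wdist k)//; exact: measurableC.
- by move=> t h /=; rewrite in_itv.
Qed.

Lemma prodW01 t j : (forall k, (0 < W k t <= 1)%R) -> (0 < Pi j t <= 1)%R.
Proof.
move=> h; rewrite /Pi; apply/andP; split.
  by apply: prodr_gt0 => k _; case/andP: (h k).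
by apply: prodr_ile1 => k _; case/andP: (h k) => /ltW -> ->.
Qed.

(** The same recursion as [level_meanS]: thinning splits the kernel at Pi_j W_j almost surely, and
    independence of Pi_j and W_j factors the integral. *)
Lemma prodWS_mean n m D j : (0 < D <= m)%N ->
  \int[P]_t (child_kernel n m (Pi j.+1 t))%:E =
  \esum_(k in [set k | (D <= k)%N])
    ((\int[P]_t (child_kernel n k (Pi j t))%:E) *
     \int[Wlaw]_w (child_kernel k m w)%:E).
Proof.
move=> /andP[D0 Dm].
have mck a b (Z : T -> R) : measurable_fun setT Z ->
    measurable_fun setT (fun t => child_kernel a b (Z t)).
  by move=> mZ; exact: (measurableT_comp (measurable_child_kernel a b)).
transitivity (\int[P]_t \esum_(k in [set: nat])
    (child_kernel n k (Pi j t) * child_kernel k m (W j t))%:E).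
  apply: ge0_ae_eq_integral => //.
  - by apply/measurable_EFinP/mck; exact: measurable_prodW.
  - apply: measurable_esum => [k|k t]; last by rewrite lee_fin mulr_ge0 ?child_kernel_ge0.
    apply/measurable_EFinP/measurable_funM; last exact: mck.
    by apply: mck; exact: measurable_prodW.
  - by move=> t _; rewrite lee_fin child_kernel_ge0.
  - by move=> t _; apply: esum_ge0 => k _; rewrite lee_fin mulr_ge0 ?child_kernel_ge0.
  apply: filterS ae_W01 => t h _; rewrite child_kernel_thin//; last exact: prodW01.
  - by rewrite /Pi big_ord_recr.
  - exact: leq_trans D0 Dm.
rewrite integral_esum; last 2 first.
- move=> k; apply/measurable_EFinP/measurable_funM; last exact: mck.
  by apply: mck; exact: measurable_prodW.
- by move=> k t; rewrite lee_fin mulr_ge0 ?child_kernel_ge0.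
(* Terms with k < D vanish because k < D <= m; this matches the fact that nodes holding fewer than D
   items do not split. *)
rewrite [RHS]esum_mkcond; apply: eq_esum => k _; case: ifPn => [/set_mem/= Dk|/negP Dk]; last first.
  rewrite integral0_eq// => t _; rewrite /child_kernel /binomial_pmf (@bin_small k m).
    by rewrite mulr0n mul0r if_same mulr0.
  by apply: leq_trans Dm; rewrite ltnNge; apply/negP => kD; apply/Dk/mem_set.
transitivity (\int[P]_s \int[P]_t (child_kernel n k (Pi j t) * child_kernel k m (W j s))%:E).
  apply: (integral_indep (X := Pi j) (Y := W j)
    (f := fun z => (child_kernel n k z.1 * child_kernel k m z.2)%:E)) => //.
  - exact: measurable_prodW.
  - move=> A B mA mB; apply: (@independent_prodW _ (Some j)) => //=.
    by exists B => //; rewrite setTI.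
  - apply/measurable_EFinP/measurable_funM.
      exact: (measurableT_comp (measurable_child_kernel n k) measurable_fst).
    exact: (measurableT_comp (measurable_child_kernel k m) measurable_snd).
  - by move=> z; rewrite lee_fin mulr_ge0 ?child_kernel_ge0.
have -> : \int[Wlaw]_w (child_kernel k m w)%:E = \int[P]_s (child_kernel k m (W j s))%:E.
  transitivity (\int[distribution P (W j)]_w (child_kernel k m w)%:E).
    by apply: eq_measure_integral => A mA _; exact: (esym (Wdist j mA)).
  rewrite ge0_integral_distribution//.
    by apply/measurable_EFinP; exact: measurable_child_kernel.
  by move=> w; rewrite lee_fin child_kernel_ge0.
rewrite -ge0_integralZl//; last 3 first.
- by apply/measurable_EFinP; exact: mck.
- by move=> s _; rewrite lee_fin child_kernel_ge0.
- by apply: integral_ge0 => t _; rewrite lee_fin child_kernel_ge0.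
apply: eq_integral => s _; rewrite muleC -ge0_integralZl//.
- by apply: eq_integral => t _; rewrite mulrC EFinM.
- by apply/measurable_EFinP/mck; exact: measurable_prodW.
- by move=> t _; rewrite lee_fin child_kernel_ge0.
- by rewrite lee_fin child_kernel_ge0.
Qed.
End products.

(** * The order statistic compared with products of weights *)

Lemma binomial_pmf1 (R : realType) (n m : nat) :
  binomial_pmf n (1 : R) m = (n == m)%:R.
Proof.
rewrite /binomial_pmf /unstable.onem subrr expr1n mul1r.
have [lt_nm|lt_mn|->] := ltngtP n m; first by rewrite bin_small.
  by rewrite expr0n subn_eq0 leqNgt lt_mn mul0rn.
by rewrite subnn expr0 binn.
Qed.

(* For [z = (y, p)] this is [1_{y <= p} / p], and [0] at [p = 0]. *)
Definition inv_above (R : realType) (z : R * R) : R :=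
  if (0 <= z.2 <= 1) && (z.1 <= z.2) then z.2^-1 else 0.

Lemma inv_above_ge0 (R : realType) (z : R * R) : 0 <= inv_above z.
Proof. by rewrite /inv_above; case: ifP => // /andP[/andP[? _] _]; rewrite invr_ge0. Qed.

Lemma measurable_inv_above (R : realType) :
  measurable_fun [set: R * R] (@inv_above R).
Proof.
apply: measurable_fun_ifT => //; last first.
  exact: (measurableT_comp (@measurable_inv R) measurable_snd).
apply: measurable_and; first apply: measurable_and.
- exact: measurable_fun_ler.
- exact: measurable_fun_ler.
- exact: measurable_fun_ler.
Qed.

Lemma esum_child_kernel_ge (R : realType) (n D : nat) (p : R) :
  \esum_(m in [set m | (D <= m)%N]) (child_kernel n m p)%:E =
  (if 0 <= p <= 1 then (\sum_(D <= m < n.+1) binomial_pmf n p m) / p else 0)%:E.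
Proof.
rewrite esum_mkcond (esum_support (e := @nat_of_ord n.+1)).
- rewrite esum_finType => [|m]; last first.
    by case: ifP => // _; rewrite lee_fin child_kernel_ge0.
  rewrite (big_nat_widenl _ 0)// big_mkord.
  have memD (m : nat) : (m \in [set m | (D <= m)%N]) = (D <= m)%N.
    by apply/idP/idP => [/set_mem|?]; [|exact: mem_set].
  under eq_bigr do rewrite memD.
  rewrite -big_mkcond/= sumEFin /child_kernel; congr (_%:E).
  by case: ifP => _; [rewrite mulr_suml|rewrite big1].
- exact: val_inj.
- move=> m mn; rewrite /child_kernel /binomial_pmf (@bin_small n m) ?mulr0n ?mul0r ?if_same//.
  by rewrite ltnNge; apply/negP => mn'; apply: mn; exists (Ordinal (mn' : (m < n.+1)%N)).
Qed.

Section order_statistic_products.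
Context d (T : measurableType d) (R : realType) (P : probability T R).
Variables (W : nat -> {RV P >-> R}) (D n : nat) (U : 'I_n -> {RV P >-> R}) (Y : T -> R).
Hypothesis Dn : (0 < D <= n)%N.
Hypothesis Udist : forall j (A : set R), measurable A ->
  distribution P (U j) A = uniform_prob (@ltr01 R) A.
Hypothesis Uindep : mutually_independent P (fun j => sigma_of (U j)).
Hypothesis YE : forall t, Y t = order_statistic D (fun j => U j t).
Hypothesis indepWY : mutually_independent P
  (fun k : option nat => if k is Some k then sigma_of (W k) else sigma_of Y).

Lemma measurable_orderY : measurable_fun setT Y.
Proof. by rewrite (funext YE); exact: measurable_order_statistic. Qed.

Lemma orderY_cdf (p : R) : 0 <= p <= 1 ->
  P [set t | Y t <= p] = (\sum_(D <= m < n.+1) binomial_pmf n p m)%:E.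
Proof.
move=> p01; rewrite -(order_statistic_cdf Dn p01 Udist Uindep).
by congr (P _); apply/seteqP; split => t /=; rewrite YE.
Qed.

(** The distribution function equals 1 at p = 1. This serves the term i = 0 of the final sum, where
    the empty product is 1. *)
Lemma ae_orderY_le1 : {ae P, forall t, Y t <= 1}.
Proof.
have mY1 : measurable [set t | Y t <= 1].
  rewrite -[X in measurable X]setTI (_ : [set t | _] = Y @^-1` `]-oo, 1]).
    by apply: measurable_orderY.
  by apply/seteqP; split => t /=; rewrite in_itv.
exists (~` [set t | Y t <= 1]); split => //; first exact: measurableC.
rewrite probability_setC// orderY_cdf ?ler01 ?lexx//.
case/andP: Dn => _ hDn; rewrite big_nat_recr//= binomial_pmf1 eqxx.
rewrite big_nat_cond big1 ?add0r ?subee// => m /andP[/andP[_ mn] _].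
by rewrite binomial_pmf1 gtn_eqF.
Qed.

Local Open Scope ereal_scope.

(** By independence the product can be frozen at a value p. Then P(Y <= p) / p is the sum over m >=
    D of the binomial probabilities divided by p, that is, of the kernels. *)
Lemma inv_above_mean j :
  \int[P]_t (inv_above (Y t, \prod_(k < j) W k t)%R)%:E =
  \esum_(m in [set m | (D <= m)%N])
    \int[P]_t (child_kernel n m (\prod_(k < j) W k t)%R)%:E.
Proof.
have mPi := measurable_prodW W j.
have mck m : measurable_fun setT (fun t => (child_kernel n m (\prod_(k < j) W k t)%R)%:E).
  by apply/measurable_EFinP; exact: (measurableT_comp (measurable_child_kernel n m) mPi).
transitivity (\int[P]_t \esum_(m in [set m | (D <= m)%N])
    (child_kernel n m (\prod_(k < j) W k t)%R)%:E); last first.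
  under eq_integral do rewrite esum_mkcond.
  rewrite integral_esum; last 2 first.
  - by move=> m; case: (m \in _).
  - by move=> m t; case: ifP => // _; rewrite lee_fin child_kernel_ge0.
  by rewrite [RHS]esum_mkcond; apply: eq_esum => m _; case: ifP => _ //; rewrite integral0.
transitivity (\int[P]_s \int[P]_t (inv_above (Y t, \prod_(k < j) W k s)%R)%:E).
  apply: (integral_indep (X := Y) (Y := fun t => (\prod_(k < j) W k t)%R)
    (f := fun z => (inv_above z)%:E)) => //.
  - exact: measurable_orderY.
  - move=> A B mA mB; rewrite setIC muleC.
    apply: (@independent_prodW _ _ _ _ _ _ measurable_orderY indepWY j None) => //.
    by exists A => //; rewrite setTI.
  - by apply/measurable_EFinP; exact: measurable_inv_above.
  - by move=> z; rewrite lee_fin inv_above_ge0.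
apply: eq_integral => s _; rewrite esum_child_kernel_ge /inv_above /=.
set p := (\prod_(k < j) W k s)%R.
have [p01|_] := boolP (0 <= p <= 1)%R; last by rewrite integral0_eq.
have mYp : measurable [set t | (Y t <= p)%R].
  rewrite -[X in measurable X]setTI (_ : [set t | _] = Y @^-1` `]-oo, p]).
    by apply: measurable_orderY.
  by apply/seteqP; split => t /=; rewrite in_itv.
rewrite mulrC EFinM -orderY_cdf// -[X in P X]setIT -integral_indic//.
have p0 : (0 <= p^-1)%R by rewrite invr_ge0; case/andP: p01.
rewrite -ge0_integralZl//; last by apply/measurable_EFinP; exact: measurable_indic.
apply: eq_integral => t _; rewrite indicE -EFinM; congr (_%:E).
have [Yp|Yp] := boolP (Y t <= p)%R; first by rewrite mem_set//= mulr1.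
by rewrite memNset ?mulr0//=; exact/negP.
Qed.

End order_statistic_products.

(** * The formula for the mean cost *)

Theorem proposition6 (R : realType)
    (D : nat) (hD : (2 <= D)%N)
    (* branching degree and splitting vectors *)
    (d0 : measure_display) (T0 : measurableType d0) (P0 : probability T0 R)
    (G0 : {RV P0 >-> nat}) (V0 : forall l : nat, 'I_l -> {RV P0 >-> R})
    (hparam : splitting_parameters G0 V0)
    (hA : assumption_A V0)
    (Wlaw : probability R R) (hWlaw : is_splitting_measure G0 V0 Wlaw)
    (* the splitting algorithm *)
    (d1 : measure_display) (T1 : measurableType d1) (P1 : probability T1 R)
    (G : seq nat -> {RV P1 >-> nat}) (V : seq nat -> nat -> {RV P1 >-> R})
    (N : seq nat -> nat -> nat -> {RV P1 >-> nat})
    (halg : splitting_realization G0 V0 D G V N)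
    (* the size of the initial set of items *)
    (n : nat) (hn : (D <= n)%N)
    (* the sequence with law Wlaw and the independent uniform variables *)
    (d2 : measure_display) (T2 : measurableType d2) (P2 : probability T2 R)
    (W : nat -> {RV P2 >-> R})
    (hWdist : forall k (A : set R), measurable A ->
       distribution P2 (W k) A = Wlaw A)
    (U : 'I_n -> {RV P2 >-> R})
    (hUdist : forall j (A : set R), measurable A ->
       distribution P2 (U j) A = uniform_prob (@ltr01 R) A)
    (hUindep : mutually_independent P2 (fun j => sigma_of (U j)))
    (UD : T2 -> R)
    (hUD : forall t, UD t = order_statistic D (fun j => U j t))
    (* the W k are mutually independent, and independent of UD *)
    (hWindep : mutually_independent P2
       (fun k : option nat =>
          if k is Some k then sigma_of (W k) else sigma_of UD)) :
  (\int[P1]_t cost D G N n t =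
   1 + (\int[P0]_t (G0 t)%:R%:E) *
       \int[P2]_t
         (\sum_(0 <= i <oo | i%:R%:E <= crossing_time (W ^~ t) (UD t) - 1)
            ((\prod_(k < i) W k t)^-1)%:E))%E.
Proof.
have D0 : (0 < D)%N by exact: leq_trans hD.
have Dn : (0 < D <= n)%N by rewrite D0.
have mUD := measurable_orderY Dn hUD.
have W01 := splitting_measure_support hparam hWlaw.
have aeW := ae_W01 hWdist W01.
rewrite (mean_cost hparam halg); congr (1 + _ * _)%E.
(* The tree and the products satisfy the same recursion in j; at j = 0 both sides are the indicator
   of n = m. *)
have levelE j m : (D <= m)%N -> level_mean D G N n j m =
    (\int[P2]_t (child_kernel n m (\prod_(k < j) W k t))%:E)%E.
  elim: j m => [|j IH] m Dm.
    rewrite level_mean0; under eq_integral do rewrite big_ord0.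
    rewrite integral_cst//= probability_setT mule1; congr (_%:E).
    by rewrite /child_kernel ler01 lexx/= divr1 binomial_pmf1.
  rewrite (level_meanS hparam halg n hWlaw j (leq_trans D0 Dm)).
  rewrite (@prodWS_mean _ _ _ _ _ _ mUD hWindep _ hWdist W01 n m D j); last by rewrite D0.
  by apply: eq_esum => k /= Dk; rewrite IH.
transitivity (\esum_(j in [set: nat])
    \int[P2]_t (inv_above (UD t, \prod_(k < j) W k t))%:E)%E.
  apply: eq_esum => j _; rewrite (inv_above_mean Dn hUdist hUindep hUD hWindep).
  by apply: eq_esum => m /= Dm; rewrite levelE.
have mprod i := measurable_prodW W i.
have minv i : measurable_fun setT
    (fun t => (inv_above (UD t, \prod_(k < i) W k t))%:E).
  apply/measurable_EFinP; apply: (measurableT_comp (@measurable_inv_above R)).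
  exact: measurable_fun_pair.
rewrite -integral_esum//; last by move=> i t; rewrite lee_fin inv_above_ge0.
(* From here the integrands are compared pointwise on the almost sure event where the weights lie in
   []0, 1]] and UD is at most 1. *)
apply: ae_eq_integral_nonmeasurable.
apply: filterS2 aeW (ae_orderY_le1 Dn hUdist hUindep hUD) => t Wt Y1.
have prod01 i := prodW01 i Wt.
have prod_noninc : nonincreasing_seq (fun i => \prod_(k < i) W k t).
  apply/nonincreasing_seqP => i; rewrite big_ord_recr/= ler_piMr//.
    by rewrite ltW//; case/andP: (prod01 i).
  by case/andP: (Wt i).
rewrite nneseries_esum => [|i _]; last by rewrite lee_fin invr_ge0 ltW//; case/andP: (prod01 i).
rewrite [RHS]esum_mkcond; apply: eq_esum => i _.
have [p0 p1] := andP (prod01 i).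
rewrite /inv_above /= (ltW p0) p1 /=.
(* The products decrease, so the bound at index i implies all earlier ones. Conversely the last
   bound is the one at i, except for i = 0, where UD <= 1 is used. *)
have -> : (i \in [set x : nat | (x%:R%:E <= crossing_time (W ^~ t) (UD t) - 1)%E]) =
    (UD t <= \prod_(k < i) W k t).
  apply/idP/idP => [/set_mem/=|UDp]; last apply/mem_set; rewrite /= le_crossing_time.
    move=> /forallP h; case: i {p0 p1} h => [_|i h]; first by rewrite big_ord0.
    exact: (h ord_max).
  apply/forallP => j; apply: le_trans UDp _; exact: prod_noninc.
by case: ifP.
Qed.
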